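(* For every $c\in(0,1)$, \[ \Pr\bigl[L^{main}\le c\ln n\,\big|\,\mathbf{COND}\bigr]=e^{-(K(c)+o(1))\ln n}\qquad(n\to\infty), \] where $K(c)=\frac{(1-c)^2}{8c}$.
   Context: For $n$ large let $A=\lfloor\ln^{10}n\rfloor$. Let $\xi_1,\dots,\xi_{2n-2}$ be i.i.d. uniform on $\{-1,+1\}$, $S_t=\sum_{i=1}^t\xi_i$ ($S_0=0$). $\mathbf{COND}$ is the event $\{S_{2A-2}=0\}\cap\{S_{2n-2}=0\}$, and $L^{main}=\sum_{i=2A-1}^{2n-2}S_i^2/i^2$. *)

(* Defs.v *)
From Stdlib Require Import Reals Lra Lia ZArith List Bool.
Import ListNotations.
Open Scope R_scope.

(* All sign sequences of length m, encoded as lists of bools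
   (true = +1, false = -1); each has probability 2^{-m}. *)
Fixpoint bool_seqs (m : nat) : list (list bool) :=
  match m with
  | O => [[]]
  | S m' => flat_map (fun l => [true :: l; false :: l]) (bool_seqs m')
  end.

Definition step (b : bool) : Z := if b then 1%Z else (-1)%Z.

Definition Spart (xs : list bool) (t : nat) : Z :=
  fold_right Z.add 0%Z (map step (firstn t xs)).

Definition Apar (n : nat) : nat := Z.to_nat (Int_part (ln (INR n) ^ 10)).

Definition COND (n : nat) (xs : list bool) : bool :=
  Z.eqb (Spart xs (2 * Apar n - 2)) 0 && Z.eqb (Spart xs (2 * n - 2)) 0.

Definition Lmain (n : nat) (xs : list bool) : R :=
  fold_right Rplus 0
    (map (fun i => (IZR (Spart xs i)) ^ 2 / (INR i) ^ 2)
         (seq (2 * Apar n - 1) (2 * n - 2 * Apar n))).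

Definition Rleb (x y : R) : bool := if Rle_dec x y then true else false.

Definition cond_prob (n : nat) (c : R) : R :=
  INR (length (filter (fun xs => COND n xs && Rleb (Lmain n xs) (c * ln (INR n)))
                      (bool_seqs (2 * n - 2))))
  / INR (length (filter (COND n) (bool_seqs (2 * n - 2)))).

Definition Kfun (c : R) : R := (1 - c) ^ 2 / (8 * c).

(* Main.v *)
Require Import Defs.
From Stdlib Require Import Reals Lra Lia Psatz ZArith List Bool.
From Coquelicot Require Import Coquelicot.
Import ListNotations.
Open Scope R_scope.

(** In logarithmic time [S_t / sqrt t] is an Ornstein-Uhlenbeck process, and with
    [theta = (l ^ 2 + l) / 2] the function [t ^ (l / 2) exp (- l x ^ 2 / (2 t))] is harmonic
    for the walk killed at rate [theta x ^ 2 / t ^ 2].  Conditioned on COND, the walk from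
    time [2A - 2] on is a Markov chain with drift [- x / r], [r] being the remaining time.
    Small perturbations of the harmonic function, of the form [exp (- g t - a t x ^ 2)] and
    [exp (- al t x ^ 4 - be t x ^ 2 - ga t)], are exactly super- and subharmonic for this
    chain, by [cosh y <= exp (y ^ 2 / 2)] and [cosh y >= exp (y ^ 2 / 2 - y ^ 4 / 12)].
    Hence [E (exp (- theta L) | COND) = n ^ (- l / 2 + o(1))] for all [l > 0].
    Markov's inequality at [l = (1 - c) / (2 c)] gives the upper bound.  For the lower
    bound, tilting by a slightly larger [l] makes [L / ln n] concentrate just below [c]. *)

(** * Gaussian bounds on hyperbolic functions *)

Lemma nonneg_derivative_ge (f f' : R -> R) :
  (forall y, is_derive f y (f' y)) -> (forall y, 0 <= y -> 0 <= f' y) ->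
  forall y, 0 <= y -> f 0 <= f y.
Proof.
  intros Hd Hp y Hy.
  destruct (Req_dec y 0) as [->|Hne]; [lra|].
  destruct (MVT_cor2 f f' 0 y) as [c [Hc Hc2]]; [lra| |].
  - intros c _. apply is_derive_Reals, Hd.
  - assert (0 <= f' c) by (apply Hp; lra). nra.
Qed.

Lemma exp_monotone x y : x <= y -> exp x <= exp y.
Proof. intros [H| ->]; [left; now apply exp_increasing|right; reflexivity]. Qed.

Lemma cosh_pos y : 0 < cosh y.
Proof. unfold cosh. pose proof (exp_pos y). pose proof (exp_pos (- y)). lra. Qed.

Lemma cosh_even y : cosh (- y) = cosh y.
Proof. unfold cosh. rewrite Ropp_involutive. lra. Qed.

Lemma sinh_odd y : sinh (- y) = - sinh y.
Proof. unfold sinh. rewrite Ropp_involutive. lra. Qed.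

Lemma sinh_nonneg y : 0 <= y -> 0 <= sinh y.
Proof.
  intros Hy. unfold sinh.
  assert (exp (- y) <= exp y); [|lra].
  destruct (Req_dec y 0) as [->|]; [rewrite Ropp_0; lra|].
  left. apply exp_increasing. lra.
Qed.

Lemma sinh_le_mul_cosh y : 0 <= y -> sinh y <= y * cosh y.
Proof.
  intros Hy.
  cut (0 * cosh 0 - sinh 0 <= y * cosh y - sinh y).
  { rewrite sinh_0. lra. }
  apply (nonneg_derivative_ge (fun y => y * cosh y - sinh y) (fun y => y * sinh y));
    [| |assumption].
  - intros z. unfold cosh, sinh. auto_derive; [trivial|field].
  - intros z Hz. pose proof (sinh_nonneg z Hz). nra.
Qed.

(** This is [tanh y >= y - y ^ 3 / 3]; the derivative of the difference is a sum of two terms that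
    are nonnegative for [y >= 0]. *)
Lemma sinh_ge_cubic_mul_cosh y : 0 <= y -> (y - y ^ 3 / 3) * cosh y <= sinh y.
Proof.
  intros Hy.
  cut (sinh 0 - (0 - 0 ^ 3 / 3) * cosh 0 <= sinh y - (y - y ^ 3 / 3) * cosh y).
  { rewrite sinh_0. lra. }
  apply (nonneg_derivative_ge (fun y => sinh y - (y - y ^ 3 / 3) * cosh y)
    (fun y => y * (y * cosh y - sinh y) + y ^ 3 / 3 * sinh y)); [| |assumption].
  - intros z. unfold cosh, sinh. auto_derive; [trivial|field].
  - intros z Hz. pose proof (sinh_nonneg z Hz). pose proof (sinh_le_mul_cosh z Hz).
    assert (0 <= z ^ 3) by (apply pow_le; lra). nra.
Qed.

Lemma cosh_le_gauss y : cosh y <= exp (y ^ 2 / 2).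
Proof.
  assert (H : forall y, 0 <= y -> cosh y <= exp (y ^ 2 / 2)).
  { clear y. intros y Hy.
    cut (- (cosh 0 * exp (- (0 ^ 2 / 2))) <= - (cosh y * exp (- (y ^ 2 / 2)))).
    { rewrite cosh_0. replace (- (0 ^ 2 / 2)) with 0 by lra. rewrite exp_0. intros H.
      assert (Hm : exp (y ^ 2 / 2) * exp (- (y ^ 2 / 2)) = 1).
      { rewrite <- exp_plus, Rplus_opp_r. apply exp_0. }
      pose proof (exp_pos (- (y ^ 2 / 2))). nra. }
    apply (nonneg_derivative_ge (fun y => - (cosh y * exp (- (y ^ 2 / 2))))
      (fun y => (y * cosh y - sinh y) * exp (- (y ^ 2 / 2)))); [| |assumption].
    - intros z. unfold cosh, sinh. auto_derive; [trivial|].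
      replace (z * (z * 1)) with (z ^ 2) by ring. unfold Rdiv. field.
    - intros z Hz. pose proof (sinh_le_mul_cosh z Hz).
      pose proof (exp_pos (- (z ^ 2 / 2))). nra. }
  destruct (Rle_dec 0 y) as [Hy|Hy]; [now apply H|].
  rewrite <- cosh_even. replace (y ^ 2 / 2) with ((- y) ^ 2 / 2) by field.
  apply H. lra.
Qed.

(** The exponent is the antiderivative of [y - y ^ 3 / 3], so the cubic lower bound on [tanh] makes
    [cosh y] divided by the exponential nondecreasing on [y >= 0]; evenness does the rest. *)
Lemma cosh_ge_gauss y : exp (y ^ 2 / 2 - y ^ 4 / 12) <= cosh y.
Proof.
  assert (H : forall y, 0 <= y -> exp (y ^ 2 / 2 - y ^ 4 / 12) <= cosh y).
  { clear y. intros y Hy.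
    cut (cosh 0 * exp (- (0 ^ 2 / 2 - 0 ^ 4 / 12)) <=
         cosh y * exp (- (y ^ 2 / 2 - y ^ 4 / 12))).
    { rewrite cosh_0. replace (- (0 ^ 2 / 2 - 0 ^ 4 / 12)) with 0 by lra. rewrite exp_0.
      intros H. set (u := y ^ 2 / 2 - y ^ 4 / 12) in *.
      assert (Hm : exp u * exp (- u) = 1).
      { rewrite <- exp_plus, Rplus_opp_r. apply exp_0. }
      pose proof (exp_pos (- u)). nra. }
    apply (nonneg_derivative_ge (fun y => cosh y * exp (- (y ^ 2 / 2 - y ^ 4 / 12)))
      (fun y => (sinh y - (y - y ^ 3 / 3) * cosh y) * exp (- (y ^ 2 / 2 - y ^ 4 / 12))));
      [| |assumption].
    - intros z. unfold cosh, sinh. auto_derive; [trivial|].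
      match goal with |- context [exp (- (?a + - ?b))] =>
        replace (- (a + - b)) with (- (z ^ 2 / 2 - z ^ 4 / 12)) by field end.
      unfold Rdiv. field.
    - intros z Hz. pose proof (sinh_ge_cubic_mul_cosh z Hz).
      pose proof (exp_pos (- (z ^ 2 / 2 - z ^ 4 / 12))). nra. }
  destruct (Rle_dec 0 y) as [Hy|Hy]; [now apply H|].
  rewrite <- cosh_even.
  replace (y ^ 2 / 2 - y ^ 4 / 12) with ((- y) ^ 2 / 2 - (- y) ^ 4 / 12) by field.
  apply H. lra.
Qed.

Lemma cosh_ge_1 y : 1 <= cosh y.
Proof.
  unfold cosh. rewrite exp_Ropp. pose proof (exp_pos y) as He.
  assert (exp y + / exp y - 2 = (exp y - 1) ^ 2 * / exp y) by (field; lra).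
  assert (0 <= (exp y - 1) ^ 2 * / exp y).
  { apply Rmult_le_pos; [apply pow2_ge_0|]. left. now apply Rinv_0_lt_compat. }
  lra.
Qed.

Lemma mul_sinh_nonneg z y : 0 <= z * y -> 0 <= z * sinh y.
Proof.
  intros Hzy. destruct (Rle_dec 0 y) as [Hy|Hy].
  - pose proof (sinh_nonneg y Hy).
    destruct (Req_dec y 0) as [->|]; [rewrite sinh_0; lra|]. 
    assert (0 <= z) by nra. nra.
  - pose proof (sinh_nonneg (- y) ltac:(lra)) as H. rewrite sinh_odd in H.
    assert (z <= 0) by nra. nra.
Qed.

Lemma cosh_le_cosh_add u v : 0 <= u * v -> cosh u <= cosh (u + v).
Proof.
  intros Huv.
  assert (Hadd : cosh (u + v) = cosh u * cosh v + sinh u * sinh v).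
  { unfold cosh, sinh. rewrite Ropp_plus_distr, !exp_plus. field. }
  pose proof (cosh_ge_1 v). pose proof (cosh_ge_1 u).
  assert (0 <= u * sinh v) by (now apply mul_sinh_nonneg).
  assert (0 <= sinh v * sinh u) by (apply mul_sinh_nonneg; lra).
  nra.
Qed.

(** The left side is the moment generating function of a [+1]/[-1] step with mean [z]. It is at most
    [cosh y * (1 + z * y)], and each factor has an exponential bound. *)
Lemma biased_cosh_le z y :
  0 <= z * y -> cosh y + z * sinh y <= exp (y ^ 2 / 2 + z * y).
Proof.
  intros Hzy.
  assert (Hs : z * sinh y <= z * y * cosh y).
  { destruct (Rle_dec 0 y) as [Hy|Hy].
    - pose proof (sinh_le_mul_cosh y Hy).
      destruct (Req_dec y 0) as [->|]; [rewrite sinh_0; lra|]. 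
      assert (0 <= z) by nra. nra.
    - pose proof (sinh_le_mul_cosh (- y) ltac:(lra)) as H.
      rewrite sinh_odd, cosh_even in H. assert (z <= 0) by nra. nra. }
  rewrite exp_plus.
  pose proof (cosh_le_gauss y). pose proof (cosh_pos y).
  pose proof (exp_ineq1_le (z * y)). nra.
Qed.

(** * Weighted bridge counts *)

Fixpoint bridges (r : nat) (x : Z) : R :=
  match r with
  | O => if Z.eqb x 0 then 1 else 0
  | S r' => bridges r' (x + 1) + bridges r' (x - 1)
  end.

(* [wbridges w t r x] sums, over the [r]-step paths from height [x] at time [t] to height 0,
   the weights [exp (- w s * h ^ 2)] over the later times [s] and heights [h]. *)
Fixpoint wbridges (w : nat -> R) (t r : nat) (x : Z) : R :=
  match r with
  | O => if Z.eqb x 0 then 1 else 0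
  | S r' => exp (- w (S t) * IZR (x + 1) ^ 2) * wbridges w (S t) r' (x + 1)
            + exp (- w (S t) * IZR (x - 1) ^ 2) * wbridges w (S t) r' (x - 1)
  end.

Lemma bridges_nonneg r x : 0 <= bridges r x.
Proof.
  revert x. induction r as [|r IH]; intros x; simpl.
  - destruct (Z.eqb x 0); lra.
  - pose proof (IH (x + 1)%Z). pose proof (IH (x - 1)%Z). lra.
Qed.

Lemma bridges_even_pos k : 0 < bridges (2 * k) 0.
Proof.
  induction k as [|k IH]; [simpl; lra|].
  replace (2 * S k)%nat with (S (S (2 * k))) by lia.
  change (bridges (S (S (2 * k))) 0) with
    (bridges (2 * k) 2 + bridges (2 * k) 0 + (bridges (2 * k) 0 + bridges (2 * k) (-2))).
  pose proof (bridges_nonneg (2 * k) 2). pose proof (bridges_nonneg (2 * k) (-2)). lra.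
Qed.

(* The bridge is the Markov chain with drift [- x / r], [r] being the remaining time. *)
Lemma bridges_step r x :
  bridges r (x + 1) = bridges (S r) x * ((1 - IZR x / INR (S r)) / 2) /\
  bridges r (x - 1) = bridges (S r) x * ((1 + IZR x / INR (S r)) / 2).
Proof.
  (* With denominators cleared, both identities go through one induction: the counts at [x + 1] and
     [x - 1] are compared through [bridges r x], which the hypothesis expresses by either. *)
  assert (H : forall r x,
    2 * INR (S r) * bridges r (x + 1) = (INR (S r) - IZR x) * bridges (S r) x /\
    2 * INR (S r) * bridges r (x - 1) = (INR (S r) + IZR x) * bridges (S r) x).
  { clear r x. induction r as [|r IH]; intros x.
    - simpl. destruct (Z.eqb_spec (x + 1) 0), (Z.eqb_spec (x - 1) 0); try lia.
      + replace x with (-1)%Z by lia. lra.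
      + replace x with 1%Z by lia. lra.
      + lra.
    - destruct (IH (x + 1)%Z) as [_ H1]. destruct (IH (x - 1)%Z) as [H2 _].
      replace (x + 1 - 1)%Z with x in H1 by lia.
      replace (x - 1 + 1)%Z with x in H2 by lia.
      rewrite plus_IZR in H1. rewrite minus_IZR in H2.
      change (bridges (S (S r)) x) with (bridges (S r) (x + 1) + bridges (S r) (x - 1)).
      rewrite (S_INR (S r)). split; nra. }
  destruct (H r x) as [H1 H2].
  assert (0 < INR (S r)) by (apply lt_0_INR; lia).
  split; apply Rmult_eq_reg_l with (2 * INR (S r)); try lra.
  - rewrite H1. field. lra.
  - rewrite H2. field. lra.
Qed.

(** Supersolution principle. One step of the chain turns [a (S t)] into a quadratic exponent again:
    [2 * a ^ 2] is the Gaussian bound at [y = 2 * a * x], [2 * a / (N - t)] is the drift, and the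
    shift by one contributes the constant [a]. The factor at time [t] makes the left side match the
    summands of the recursion. *)
Lemma wbridges_le (w a g : nat -> R) (t0 N : nat) :
  (forall t, (t0 <= t < N)%nat ->
     0 <= a (S t) /\ g t <= g (S t) + a (S t) /\
     a t - a (S t) + 2 * a (S t) ^ 2 + 2 * a (S t) / INR (N - t) <= w t) ->
  g N <= 0 ->
  forall r t x, (t + r = N)%nat -> (t0 <= t)%nat ->
  exp (- w t * IZR x ^ 2) * wbridges w t r x <= bridges r x * exp (- g t - a t * IZR x ^ 2).
Proof.
  intros Hstep Hg r. induction r as [|r IH]; intros t x Ht Ht0.
  - simpl wbridges; simpl bridges. replace t with N by lia. destruct (Z.eqb_spec x 0) as [->|].
    + replace (- w N * 0 ^ 2) with 0 by ring. rewrite exp_0, !Rmult_1_l.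
      rewrite <- exp_0. apply exp_monotone. lra.
    + lra.
  - destruct (Hstep t) as (Ha & Hgt & Hw); [lia|].
    replace (N - t)%nat with (S r) in Hw by lia.
    pose proof (IH (S t) (x + 1)%Z ltac:(lia) ltac:(lia)) as H1.
    pose proof (IH (S t) (x - 1)%Z ltac:(lia) ltac:(lia)) as H2.
    destruct (bridges_step r x) as [E1 E2]. rewrite E1 in H1. rewrite E2 in H2.
    rewrite plus_IZR in H1. rewrite minus_IZR in H2.
    set (X := IZR x) in *. set (z := X / INR (S r)) in *.
    pose proof (bridges_nonneg (S r) x) as HB. set (b := bridges (S r) x) in *.
    assert (Hr : 0 < INR (S r)) by (apply lt_0_INR; lia).
    set (A := a (S t)) in *.
    assert (HzX : z * X = X ^ 2 / INR (S r)) by (unfold z; field; lra).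
    assert (Hzy : 0 <= z * (2 * A * X)).
    { replace (z * (2 * A * X)) with (2 * A * (z * X)) by ring. rewrite HzX.
      apply Rmult_le_pos; [lra|]. apply Rdiv_le_0_compat; [apply pow2_ge_0|lra]. }
    pose proof (biased_cosh_le z (2 * A * X) Hzy) as Hb.
    set (E := exp (- g (S t) - A * X ^ 2 - A)).
    assert (F1 : exp (- g (S t) - A * (X + 1) ^ 2) = E * exp (- (2 * A * X))).
    { unfold E. rewrite <- exp_plus. f_equal. ring. }
    assert (F2 : exp (- g (S t) - A * (X - 1) ^ 2) = E * exp (2 * A * X)).
    { unfold E. rewrite <- exp_plus. f_equal. ring. }
    rewrite F1 in H1. rewrite F2 in H2.
    assert (HU : wbridges w t (S r) x <= b * E * (cosh (2 * A * X) + z * sinh (2 * A * X))).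
    { cbn [wbridges]. rewrite plus_IZR, minus_IZR. fold X.
      eapply Rle_trans; [apply Rplus_le_compat; [exact H1|exact H2]|].
      right. unfold cosh, sinh. field. }
    assert (HE : 0 < E) by apply exp_pos.
    assert (HU2 : wbridges w t (S r) x <= b * (E * exp ((2 * A * X) ^ 2 / 2 + z * (2 * A * X)))).
    { assert (0 <= b * E) by nra. nra. }
    apply Rle_trans with
      (exp (- w t * X ^ 2) * (b * (E * exp ((2 * A * X) ^ 2 / 2 + z * (2 * A * X))))).
    { apply Rmult_le_compat_l; [left; apply exp_pos|exact HU2]. }
    replace (exp (- w t * X ^ 2) * (b * (E * exp ((2 * A * X) ^ 2 / 2 + z * (2 * A * X)))))
      with (b * (exp (- w t * X ^ 2) * (E * exp ((2 * A * X) ^ 2 / 2 + z * (2 * A * X)))))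
      by ring.
    apply Rmult_le_compat_l; [exact HB|].
    unfold E. rewrite <- !exp_plus. apply exp_monotone.
    replace (z * (2 * A * X)) with (2 * A / INR (S r) * X ^ 2) by (unfold z; field; lra).
    pose proof (pow2_ge_0 X). nra.
Qed.

(** Subsolution principle. The lower Gaussian bound loses [(2 * be * x) ^ 4 / 12 = 4 / 3 * be ^ 4 *
    x ^ 4], so a quartic term is carried along to absorb it. The other conditions match the
    coefficients of [x ^ 2] and [1]. *)
Lemma wbridges_ge (w al be ga : nat -> R) (t0 N : nat) :
  (forall t, (t0 <= t < N)%nat ->
     0 <= al (S t) /\ 0 <= be (S t) /\
     al (S t) + 4 / 3 * be (S t) ^ 4 <= al t /\
     w t + be (S t) - 2 * be (S t) ^ 2 + 6 * al (S t) <= be t /\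
     ga (S t) + be (S t) + al (S t) <= ga t) ->
  0 <= ga N ->
  forall r t x, (t + r = N)%nat -> (t0 <= t)%nat ->
  bridges r x * exp (- (al t * IZR x ^ 4 + be t * IZR x ^ 2 + ga t))
    <= exp (- w t * IZR x ^ 2) * wbridges w t r x.
Proof.
  intros Hstep Hg r. induction r as [|r IH]; intros t x Ht Ht0.
  - simpl wbridges; simpl bridges. replace t with N by lia. destruct (Z.eqb_spec x 0) as [->|].
    + replace (- w N * 0 ^ 2) with 0 by ring. rewrite exp_0, !Rmult_1_l.
      rewrite <- exp_0. apply exp_monotone. simpl IZR. nra.
    + lra.
  - destruct (Hstep t) as (Ha & Hb & Ca & Cb & Cg); [lia|].
    pose proof (IH (S t) (x + 1)%Z ltac:(lia) ltac:(lia)) as H1.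
    pose proof (IH (S t) (x - 1)%Z ltac:(lia) ltac:(lia)) as H2.
    destruct (bridges_step r x) as [E1 E2]. rewrite E1 in H1. rewrite E2 in H2.
    rewrite plus_IZR in H1. rewrite minus_IZR in H2.
    set (X := IZR x) in *. set (z := X / INR (S r)) in *.
    pose proof (bridges_nonneg (S r) x) as HB. set (b := bridges (S r) x) in *.
    assert (Hr : 0 < INR (S r)) by (apply lt_0_INR; lia).
    set (A := al (S t)) in *. set (D := be (S t)) in *. set (G := ga (S t)) in *.
    set (s := 2 * D * X + 4 * A * (X ^ 3 + X)).
    set (E := exp (- (A * (X ^ 4 + 6 * X ^ 2 + 1) + D * (X ^ 2 + 1) + G))).
    assert (F1 : exp (- (A * (X + 1) ^ 4 + D * (X + 1) ^ 2 + G)) = E * exp (- s)).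
    { unfold E, s. rewrite <- exp_plus. f_equal. ring. }
    assert (F2 : exp (- (A * (X - 1) ^ 4 + D * (X - 1) ^ 2 + G)) = E * exp s).
    { unfold E, s. rewrite <- exp_plus. f_equal. ring. }
    rewrite F1 in H1. rewrite F2 in H2.
    assert (HU : b * E * (cosh s + z * sinh s) <= wbridges w t (S r) x).
    { cbn [wbridges]. rewrite plus_IZR, minus_IZR. fold X.
      eapply Rle_trans; [|apply Rplus_le_compat; [exact H1|exact H2]].
      right. unfold cosh, sinh. field. }
    assert (HE : 0 < E) by apply exp_pos.
    (* The drift points towards 0 and thus only helps; its contribution is dropped. *)
    assert (Hz : 0 <= z * sinh s).
    { apply mul_sinh_nonneg.
      replace (z * s) with ((2 * D * X ^ 2 + 4 * A * (X ^ 4 + X ^ 2)) / INR (S r))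
        by (unfold z, s; field; lra).
      apply Rdiv_le_0_compat; [|lra].
      pose proof (pow2_ge_0 X). pose proof (pow2_ge_0 (X ^ 2)). nra. }
    (* The quadratic and quartic parts of [s] have the same sign, so dropping the quartic part only
       decreases [cosh s]. *)
    assert (Hc : exp ((2 * D * X) ^ 2 / 2 - (2 * D * X) ^ 4 / 12) <= cosh s).
    { eapply Rle_trans; [apply cosh_ge_gauss|]. apply cosh_le_cosh_add.
      replace (2 * D * X * (4 * A * (X ^ 3 + X))) with
        (8 * (D * A) * (X ^ 2 * X ^ 2 + X ^ 2)) by ring.
      pose proof (pow2_ge_0 X). apply Rmult_le_pos; [|nra].
      apply Rmult_le_pos; [lra|]. now apply Rmult_le_pos. }
    set (Q := exp ((2 * D * X) ^ 2 / 2 - (2 * D * X) ^ 4 / 12)) in *.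
    apply Rle_trans with (exp (- w t * X ^ 2) * (b * (E * Q))).
    2:{ apply Rmult_le_compat_l; [left; apply exp_pos|].
        assert (0 <= b * E) by nra. nra. }
    replace (exp (- w t * X ^ 2) * (b * (E * Q)))
      with (b * (exp (- w t * X ^ 2) * (E * Q))) by ring.
    apply Rmult_le_compat_l; [exact HB|].
    unfold E, Q. rewrite <- !exp_plus. apply exp_monotone.
    pose proof (pow2_ge_0 X) as HX2. pose proof (pow2_ge_0 (X ^ 2)) as HX4.
    replace ((2 * D * X) ^ 2 / 2 - (2 * D * X) ^ 4 / 12)
      with (2 * D ^ 2 * X ^ 2 - 4 / 3 * D ^ 4 * (X ^ 2) ^ 2) by field.
    replace (X ^ 4) with ((X ^ 2) ^ 2) by ring.
    nra.
Qed.

(** * Partition functions *)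

Definition Rsum {T : Type} (F : T -> R) (l : list T) : R :=
  fold_right Rplus 0 (map F l).

Lemma Rsum_cons {T} (F : T -> R) x l : Rsum F (x :: l) = F x + Rsum F l.
Proof. reflexivity. Qed.

Lemma Rsum_ext_in {T} (F G : T -> R) l :
  (forall x, In x l -> F x = G x) -> Rsum F l = Rsum G l.
Proof.
  intros H. unfold Rsum. f_equal. now apply map_ext_in.
Qed.

Lemma Rsum_le {T} (F G : T -> R) l :
  (forall x, In x l -> F x <= G x) -> Rsum F l <= Rsum G l.
Proof.
  induction l as [|x l IH]; intros H; [apply Rle_refl|].
  rewrite !Rsum_cons. apply Rplus_le_compat.
  - apply H. now left.
  - apply IH. intros y Hy. apply H. now right.
Qed.

Lemma Rsum_plus {T} (F G : T -> R) l :
  Rsum (fun x => F x + G x) l = Rsum F l + Rsum G l.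
Proof.
  induction l as [|x l IH]; [unfold Rsum; simpl; ring|]. rewrite !Rsum_cons, IH. ring.
Qed.

Lemma Rsum_scal {T} k (F : T -> R) l : Rsum (fun x => k * F x) l = k * Rsum F l.
Proof.
  induction l as [|x l IH]; [unfold Rsum; simpl; ring|]. rewrite !Rsum_cons, IH. ring.
Qed.

Lemma Rsum_filter {T} (F : T -> R) p l :
  Rsum F (filter p l) = Rsum (fun x => if p x then F x else 0) l.
Proof.
  induction l as [|x l IH]; [reflexivity|]. rewrite Rsum_cons. simpl.
  destruct (p x); [rewrite Rsum_cons, IH; reflexivity|rewrite IH; ring].
Qed.

Lemma INR_length_Rsum {T} (l : list T) : INR (length l) = Rsum (fun _ => 1) l.
Proof.
  induction l as [|x l IH]; [reflexivity|].
  rewrite Rsum_cons, <- IH. simpl length. rewrite S_INR. ring.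
Qed.

(** * Sums over sign sequences as sums over paths *)

Lemma Rsum_bool_seqs_S F m :
  Rsum F (bool_seqs (S m)) =
  Rsum (fun l => F (true :: l)) (bool_seqs m) + Rsum (fun l => F (false :: l)) (bool_seqs m).
Proof.
  cbn [bool_seqs]. induction (bool_seqs m) as [|l ls IH]; [unfold Rsum; simpl; ring|].
  cbn [flat_map app]. rewrite !Rsum_cons, IH. ring.
Qed.

Lemma Rsum_bool_seqs_add a r F :
  Rsum F (bool_seqs (a + r)) =
  Rsum (fun l => Rsum (fun l' => F (l ++ l')) (bool_seqs r)) (bool_seqs a).
Proof.
  revert F. induction a as [|a IH]; intros F.
  - symmetry. apply Rplus_0_r.
  - cbn [Nat.add]. rewrite !Rsum_bool_seqs_S, !IH. reflexivity.
Qed.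

Lemma length_bool_seqs m l : In l (bool_seqs m) -> length l = m.
Proof.
  revert l. induction m as [|m IH]; intros l Hl; cbn [bool_seqs] in Hl.
  - destruct Hl as [<-|[]]. reflexivity.
  - apply in_flat_map in Hl. destruct Hl as (l' & Hl' & Hl).
    apply IH in Hl'. destruct Hl as [<-|[<-|[]]]; simpl; congruence.
Qed.

Definition total (l : list bool) : Z := fold_right Z.add 0%Z (map step l).

Lemma total_app l l' : total (l ++ l') = (total l + total l')%Z.
Proof.
  unfold total. induction l as [|b l IH]; [reflexivity|]. simpl. rewrite IH. ring.
Qed.

Lemma Spart_app_length l l' : Spart (l ++ l') (length l) = total l.
Proof.
  unfold Spart, total. now rewrite firstn_app, Nat.sub_diag, firstn_O, app_nil_r, firstn_all.
Qed.

Fixpoint cost (w : nat -> R) (t : nat) (x : Z) (l : list bool) : R :=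
  match l with
  | [] => 0
  | b :: l' => w (S t) * IZR (x + step b) ^ 2 + cost w (S t) (x + step b) l'
  end.

Lemma wbridges_paths w t r x :
  wbridges w t r x =
  Rsum (fun l => if (x + total l =? 0)%Z then exp (- cost w t x l) else 0) (bool_seqs r).
Proof.
  revert t x. induction r as [|r IH]; intros t x.
  - change (bool_seqs 0) with [@nil bool]. rewrite Rsum_cons. unfold Rsum, total. simpl.
    rewrite Z.add_0_r, Ropp_0, exp_0. ring.
  - cbn [wbridges]. rewrite Rsum_bool_seqs_S, !IH, <- !Rsum_scal.
    f_equal; apply Rsum_ext_in; intros l _; unfold total; cbn [map fold_right step cost];
      fold (total l); rewrite Z.add_assoc.
    + destruct (Z.eqb _ _); [|ring]. rewrite <- exp_plus. f_equal. ring.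
    + destruct (Z.eqb _ _); [|ring]. rewrite <- exp_plus. f_equal. unfold Z.sub. 
      simpl Z.opp. ring.
Qed.

(** The induction moves letters from [l] to the prefix [p], whose length and total are the running
    time and height of [cost]. *)
Lemma cost_Spart w l p :
  Rsum (fun i => w i * IZR (Spart (p ++ l) i) ^ 2) (seq (S (length p)) (length l)) =
  cost w (length p) (total p) l.
Proof.
  revert p. induction l as [|b l IH]; intros p; [reflexivity|].
  specialize (IH (p ++ [b])). rewrite length_app, Nat.add_1_r, <- app_assoc in IH.
  cbn [app] in IH. cbn [length seq cost]. rewrite Rsum_cons, IH.
  replace (Spart (p ++ b :: l) (S (length p))) with (total (p ++ [b])).
  - rewrite total_app. unfold total at 2 4. simpl. now rewrite Z.add_0_r.
  - rewrite <- (Spart_app_length (p ++ [b]) l), length_app, Nat.add_1_r, <- app_assoc.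
    reflexivity.
Qed.

Lemma wbridges_zero_weight w t r x : (forall s, w s = 0) -> wbridges w t r x = bridges r x.
Proof.
  intros Hw. revert t x. induction r as [|r IH]; intros t x; [reflexivity|].
  cbn [wbridges bridges]. rewrite !IH, Hw, Ropp_0, !Rmult_0_l, exp_0. ring.
Qed.

(** Unnormalised conditional Laplace transform: dividing by [Zsum n 0], the number of sequences in
    COND, gives the conditional expectation of [exp (- th * L)]. *)
Definition Zsum (n : nat) (th : R) : R :=
  Rsum (fun xs => exp (- th * Lmain n xs)) (filter (COND n) (bool_seqs (2 * n - 2))).

(** The sum [L] starts right after time [2A - 2], where the path is pinned at 0: the first segment
    only contributes its number of bridges, and the second starts afresh. *)
Lemma Zsum_factor n th :
  (1 <= Apar n <= n)%nat ->
  Zsum n th = bridges (2 * Apar n - 2) 0 *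
    wbridges (fun i => th / INR i ^ 2) (2 * Apar n - 2) (2 * n - 2 * Apar n) 0.
Proof.
  intros HA. unfold Zsum. rewrite Rsum_filter.
  set (a := (2 * Apar n - 2)%nat). set (r := (2 * n - 2 * Apar n)%nat).
  set (w := fun i => th / INR i ^ 2).
  replace (2 * n - 2)%nat with (a + r)%nat by (unfold a, r; lia).
  rewrite Rsum_bool_seqs_add.
  rewrite <- (wbridges_zero_weight (fun _ => 0) 0 a 0) by reflexivity.
  rewrite wbridges_paths, Rmult_comm, <- Rsum_scal.
  apply Rsum_ext_in. intros l Hl. apply length_bool_seqs in Hl.
  rewrite Z.add_0_l.
  assert (H0 : forall t x, cost (fun _ => 0) t x l = 0).
  { clear. induction l as [|b l IH]; intros t x; [reflexivity|].
    cbn [cost]. rewrite IH. ring. }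
  rewrite H0, Ropp_0, exp_0. clear H0.
  destruct (Z.eqb_spec (total l) 0) as [H0|H0].
  - rewrite Rmult_1_r, wbridges_paths. apply Rsum_ext_in. intros l' Hl'.
    apply length_bool_seqs in Hl'. rewrite Z.add_0_l.
    unfold COND. replace (2 * n - 2)%nat with (a + r)%nat by (unfold a, r; lia). fold a.
    rewrite <- Hl at 1. rewrite Spart_app_length, H0.
    replace (a + r)%nat with (length (l ++ l')) by (rewrite length_app; lia).
    replace (Spart (l ++ l') (length (l ++ l'))) with (total l').
    2:{ rewrite <- (app_nil_r (l ++ l')) at 1. rewrite Spart_app_length, total_app. lia. }
    simpl andb. destruct (total l' =? 0)%Z; [|reflexivity]. f_equal.
    rewrite <- H0, <- Hl, <- (cost_Spart w l' l), Ropp_mult_distr_l_reverse. f_equal.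
    unfold Lmain. fold (Rsum (fun i => IZR (Spart (l ++ l') i) ^ 2 / INR i ^ 2)
      (seq (2 * Apar n - 1) (2 * n - 2 * Apar n))).
    rewrite <- Rsum_scal.
    replace (2 * Apar n - 1)%nat with (S (length l)) by (unfold a in Hl; lia).
    rewrite Hl'. fold r. apply Rsum_ext_in. intros i _. unfold w, Rdiv. ring.
  - rewrite Rmult_0_r. transitivity (Rsum (fun _ : list bool => 0 * 0) (bool_seqs r)).
    + apply Rsum_ext_in. intros l' _. unfold COND. fold a.
      rewrite <- Hl at 1. rewrite Spart_app_length.
      apply Z.eqb_neq in H0. rewrite H0. simpl. ring.
    + rewrite Rsum_scal. ring.
Qed.

Lemma Zsum_0 n :
  (1 <= Apar n <= n)%nat ->
  Zsum n 0 = bridges (2 * Apar n - 2) 0 * bridges (2 * n - 2 * Apar n) 0 /\ 0 < Zsum n 0.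
Proof.
  intros HA.
  assert (E : Zsum n 0 = bridges (2 * Apar n - 2) 0 * bridges (2 * n - 2 * Apar n) 0).
  { rewrite Zsum_factor by assumption. f_equal. apply wbridges_zero_weight.
    intros s. unfold Rdiv. ring. }
  split; [exact E|]. rewrite E.
  replace (2 * Apar n - 2)%nat with (2 * (Apar n - 1))%nat by lia.
  replace (2 * n - 2 * Apar n)%nat with (2 * (n - Apar n))%nat by lia.
  apply Rmult_lt_0_compat; apply bridges_even_pos.
Qed.

Lemma length_COND n : INR (length (filter (COND n) (bool_seqs (2 * n - 2)))) = Zsum n 0.
Proof.
  rewrite INR_length_Rsum. apply Rsum_ext_in. intros xs _.
  rewrite Ropp_0, Rmult_0_l, exp_0. reflexivity.
Qed.

Definition count_le (n : nat) (y : R) : R :=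
  Rsum (fun xs => if Rleb (Lmain n xs) y then 1 else 0)
    (filter (COND n) (bool_seqs (2 * n - 2))).

Lemma cond_prob_eq n c : cond_prob n c = count_le n (c * ln (INR n)) / Zsum n 0.
Proof.
  unfold cond_prob, count_le. rewrite length_COND. f_equal.
  rewrite INR_length_Rsum, !Rsum_filter. apply Rsum_ext_in. intros xs _.
  destruct (COND n xs); reflexivity.
Qed.

Lemma count_le_markov n th y :
  0 <= th -> count_le n y <= exp (th * y) * Zsum n th.
Proof.
  intros Hth. unfold count_le, Zsum. rewrite <- Rsum_scal. apply Rsum_le. intros xs _.
  rewrite <- exp_plus. unfold Rleb. destruct (Rle_dec _ _) as [H|H].
  - rewrite <- exp_0. apply exp_monotone. nra.
  - left. apply exp_pos.
Qed.

(* Under the tilted weights [exp (- th * L)], Markov's inequality bounds the mass above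
   [y] by the partition function at [th - e1] and the mass below [y'] by that at [th + e2]. *)
Lemma Zsum_tilt n th e1 e2 y y' :
  0 <= th -> 0 <= e1 -> 0 <= e2 ->
  Zsum n th <= exp (- th * y') * count_le n y
    + exp (- e1 * y) * Zsum n (th - e1) + exp (e2 * y') * Zsum n (th + e2).
Proof.
  intros Hth He1 He2. unfold count_le, Zsum.
  rewrite <- !Rsum_scal, <- !Rsum_plus. apply Rsum_le. intros xs _.
  rewrite <- !exp_plus. set (L := Lmain n xs).
  pose proof (exp_pos (- e1 * y + - (th - e1) * L)).
  pose proof (exp_pos (e2 * y' + - (th + e2) * L)).
  pose proof (exp_pos (- th * y')).
  unfold Rleb. destruct (Rle_dec L y) as [H2|H2].
  - destruct (Rle_dec L y') as [H3|H3].
    + assert (exp (- th * L) <= exp (e2 * y' + - (th + e2) * L))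
        by (apply exp_monotone; nra). lra.
    + assert (exp (- th * L) <= exp (- th * y')) by (apply exp_monotone; nra). lra.
  - assert (exp (- th * L) <= exp (- e1 * y + - (th - e1) * L))
      by (apply exp_monotone; nra). lra.
Qed.

(** * Asymptotics *)

Lemma ln_le_sub_1 y : 0 < y -> ln y <= y - 1.
Proof. intros Hy. pose proof (exp_ineq1_le (ln y)). rewrite exp_ln in H; lra. Qed.

Lemma ln_succ_bounds y : 0 < y -> / (y + 1) <= ln (y + 1) - ln y <= / y.
Proof.
  intros Hy.
  assert (0 < / y) by now apply Rinv_0_lt_compat.
  assert (0 < / (y + 1)) by (apply Rinv_0_lt_compat; lra).
  split.
  - rewrite <- (Ropp_involutive (ln (y + 1) - ln y)), Ropp_minus_distr.
    rewrite <- ln_div by lra.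
    pose proof (ln_le_sub_1 (y / (y + 1)) ltac:(apply Rdiv_lt_0_compat; lra)) as H1.
    replace (y / (y + 1) - 1) with (- / (y + 1)) in H1 by (field; lra). lra.
  - rewrite <- ln_div by lra.
    pose proof (ln_le_sub_1 ((y + 1) / y) ltac:(apply Rdiv_lt_0_compat; lra)) as H1.
    replace ((y + 1) / y - 1) with (/ y) in H1 by (field; lra). lra.
Qed.

Lemma eventually_ln_ge K : eventually (fun n => 1 < INR n /\ K <= ln (INR n)).
Proof.
  destruct (INR_unbounded (exp K + 1)) as [N HN].
  exists N. intros n Hn. apply le_INR in Hn. pose proof (exp_pos K). split; [lra|].
  rewrite <- (ln_exp K). apply ln_le; lra.
Qed.

(** The upper bound makes [ln A] negligible against [ln n]; the crude lower bound suffices for [A]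
    to tend to infinity. *)
Lemma Apar_bounds n :
  1 <= ln (INR n) ->
  INR (Apar n) <= ln (INR n) ^ 10 /\ ln (INR n) - 1 <= INR (Apar n).
Proof.
  intros HT. set (T := ln (INR n)) in *. unfold Apar. fold T.
  destruct (base_Int_part (T ^ 10)) as [H1 H2].
  assert (H3 : T <= T ^ 10).
  { rewrite <- (pow_1 T) at 1. apply Rle_pow; [lra|lia]. }
  assert (0 <= Int_part (T ^ 10))%Z.
  { apply Z.lt_succ_r, lt_IZR. rewrite succ_IZR. lra. }
  rewrite INR_IZR_INZ, Z2Nat.id by assumption. lra.
Qed.

Lemma eventually_Apar_ge K : eventually (fun n => K <= INR (Apar n)).
Proof.
  apply filter_imp with (2 := eventually_ln_ge (Rmax 1 (K + 1))).
  intros n [_ Hn].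
  pose proof (Rmax_l 1 (K + 1)). pose proof (Rmax_r 1 (K + 1)).
  destruct (Apar_bounds n); lra.
Qed.

Lemma eventually_ln_Apar_le d K :
  0 < d -> eventually (fun n => ln (2 * INR (Apar n)) + K <= d * ln (INR n)).
Proof.
  intros Hd.
  (* [ln y <= y - 1] at [y = d / 20 * T] bounds [10 * ln T] by [d / 2 * T] plus a constant; the
     other half of [d * T] pays for [C]. *)
  set (C := ln 2 + K - 10 * ln (d / 20)).
  apply filter_imp with (2 := eventually_ln_ge (Rmax 2 (2 * C / d))).
  intros n [_ Hn].
  pose proof (Rmax_l 2 (2 * C / d)). pose proof (Rmax_r 2 (2 * C / d)).
  destruct (Apar_bounds n) as [H1 H2]; [lra|].
  set (T := ln (INR n)) in *.
  assert (HA : ln (INR (Apar n)) <= 10 * ln T).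
  { replace (10 * ln T) with (INR 10 * ln T) by (simpl; ring).
    rewrite <- ln_pow by lra. apply ln_le; lra. }
  rewrite ln_mult by lra.
  pose proof (ln_le_sub_1 (d / 20 * T) ltac:(nra)) as H3.
  rewrite ln_mult in H3 by lra.
  assert (C <= d / 2 * T).
  { replace C with (d / 2 * (2 * C / d)) by (field; lra).
    apply Rmult_le_compat_l; lra. }
  unfold C in *. lra.
Qed.

Lemma eventually_Apar_range : eventually (fun n => (2 <= Apar n <= n)%nat).
Proof.
  apply filter_imp with (2 := filter_and _ _ (eventually_ln_ge 0)
    (filter_and _ _ (eventually_Apar_ge 2) (eventually_ln_Apar_le 1 0 ltac:(lra)))).
  intros n ([Hn _] & HA & HL).
  assert (2 * INR (Apar n) <= INR n).
  { rewrite <- (exp_ln (2 * INR (Apar n))), <- (exp_ln (INR n)) by lra.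
    apply exp_monotone. lra. }
  split; apply INR_le; simpl; lra.
Qed.

(** * Asymptotics of the conditional Laplace transform *)

Lemma Zsum_upper l e :
  0 < l -> 0 < e ->
  eventually (fun n => Zsum n ((l ^ 2 + l) / 2) <=
    Zsum n 0 * exp (- (l / 2 - e) * ln (INR n))).
Proof.
  intros Hl He. set (th := (l ^ 2 + l) / 2).
  (* The supersolution lives up to time [m = N / M]. This [M] gives [(M - 1) * l >= 2], hence
     [/ (N - t) <= l / (2 * m)] for [t <= m]: the drift is controlled, at the price of a constant
     factor in time. *)
  destruct (INR_unbounded ((2 + l) / l)) as [M HM].
  assert (HMl : 2 + l <= INR M * l).
  { left. apply Rmult_lt_reg_r with (/ l); [now apply Rinv_0_lt_compat|].
    replace (INR M * l * / l) with (INR M) by (field; lra). exact HM. }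
  assert (HM1 : 1 < INR M) by nra.
  assert (HMn : (M <> 0)%nat) by (intros ->; simpl in HM1; lra).
  (* A loss of [d * T] in [g a] costs at most [e * T] after multiplication by [l / 2]; [d <= 1]
     ensures [a < m]. *)
  set (d := Rmin 1 (2 * e / l)).
  assert (Hd : 0 < d).
  { apply Rmin_glb_lt; [lra|]. apply Rdiv_lt_0_compat; lra. }
  apply filter_imp with (2 := filter_and _ _ (eventually_ln_ge 0)
    (filter_and _ _ eventually_Apar_range (eventually_ln_Apar_le d (ln (INR M) + 1) Hd))).
  intros n ([Hn _] & HA & HL).
  set (T := ln (INR n)) in *.
  assert (HT : 0 < T) by (unfold T; rewrite <- ln_1; apply ln_increasing; lra).
  set (a := (2 * Apar n - 2)%nat). set (N := (2 * n - 2)%nat). set (m := (N / M)%nat).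
  assert (Hm1 : INR M * INR m <= INR N).
  { rewrite <- mult_INR. apply le_INR. unfold m. apply Nat.Div0.mul_div_le. }
  assert (Hm2 : INR n <= INR M * (INR m + 1)).
  { rewrite <- S_INR, <- mult_INR. apply le_INR.
    pose proof (Nat.mul_succ_div_gt N M HMn). unfold m, N in *. lia. }
  assert (Hlm : T <= ln (INR M) + ln (INR m + 1)).
  { pose proof (pos_INR m). rewrite <- ln_mult by lra. apply ln_le; lra. }
  assert (HA2 : 2 <= INR (Apar n)).
  { replace 2 with (INR 2) by reflexivity. apply le_INR. lia. }
  assert (Ha : INR a + 1 <= 2 * INR (Apar n)).
  { unfold a. rewrite minus_INR, mult_INR by lia. simpl. lra. }
  pose proof (pos_INR a) as Ha0.
  assert (Hla : ln (INR a + 1) <= ln (2 * INR (Apar n))) by (apply ln_le; lra).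
  assert (Ham : (a < m)%nat).
  { apply INR_lt. pose proof (pos_INR m).
    assert (d <= 1) by apply Rmin_l.
    assert (INR a + 1 < INR m + 1); [|lra].
    apply ln_lt_inv; [lra..|]. nra. }
  assert (Hm0 : 0 < INR m) by (apply lt_0_INR; lia).
  (* The main term [l / (2 * t)] is lowered by [l / (2 * m)], which compensates the drift and makes
     [f] vanish at the cutoff; [g] is a logarithmic lower bound for the sum of [f] over the times in
     [(t, m]]. *)
  set (f := fun t => if (t <=? m)%nat then l / 2 * (/ INR t - / INR m) else 0).
  set (g := fun t => if (t <=? m)%nat then
    l / 2 * (ln (INR m + 1) - ln (INR t + 1) - (INR m - INR t) / INR m) else 0).
  assert (Hmain : wbridges (fun i => th / INR i ^ 2) a (2 * n - 2 * Apar n) 0 <=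
    bridges (2 * n - 2 * Apar n) 0 * exp (- g a)).
  { pose proof (wbridges_le (fun i => th / INR i ^ 2) f g a N) as HU.
    assert (HU' := fun h1 h2 => HU h1 h2 (2 * n - 2 * Apar n)%nat a 0%Z
      ltac:(unfold a, N; lia) (Nat.le_refl a)). clear HU. cbv beta in HU'.
    replace (- (th / INR a ^ 2) * IZR 0 ^ 2) with 0 in HU' by ring.
    replace (- g a - f a * IZR 0 ^ 2) with (- g a) in HU' by ring.
    rewrite exp_0, Rmult_1_l in HU'. apply HU'.
    - intros t Ht.
      assert (Ht0 : 0 < INR t) by (apply lt_0_INR; unfold a in Ht; lia).
      unfold f, g. destruct (Nat.leb_spec (S t) m) as [Hs|Hs].
      + replace (t <=? m)%nat with true by (symmetry; apply Nat.leb_le; lia).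
        apply le_INR in Hs.
        assert (HNt : INR (N - t) = INR N - INR t) by (apply minus_INR; lia).
        rewrite S_INR in *. rewrite HNt.
        destruct (ln_succ_bounds (INR t + 1)) as [_ Hln]; [lra|].
        assert (Hs0 : INR t < INR t + 1) by lra.
        set (s := INR t + 1) in *.
        assert (0 < / s) by (apply Rinv_0_lt_compat; lra).
        assert (0 < / INR m) by now apply Rinv_0_lt_compat.
        assert (/ INR m <= / s) by (apply Rinv_le_contravar; lra).
        repeat split.
        * nra.
        * replace ((INR m - INR t) / INR m) with ((INR m - s) / INR m + / INR m)
            by (unfold s; field; lra).
          nra.
        * assert (HNm : 2 * INR m <= l * (INR N - INR t)).
          { assert (INR t <= INR m) by lra. nra. }
          assert (HNt0 : 0 < INR N - INR t) by nra.
          assert (Hr : / (INR N - INR t) <= l / 2 * / INR m).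
          { replace (l / 2 * / INR m) with (/ (2 * INR m / l)) by (field; lra).
            apply Rinv_le_contravar; [apply Rdiv_lt_0_compat; lra|].
            apply Rmult_le_reg_r with l; [lra|].
            replace (2 * INR m / l * l) with (2 * INR m) by (field; lra). lra. }
          assert (0 < / (INR N - INR t)) by now apply Rinv_0_lt_compat.
          set (A := l / 2 * (/ s - / INR m)).
          assert (HA0 : 0 <= A) by (unfold A; nra).
          assert (HA1 : A + / (INR N - INR t) <= l / 2 * / s) by (unfold A; nra).
          assert (HA3 : A <= l / 2 * / s) by lra.
          assert (Hst : / s <= / INR t) by (apply Rinv_le_contravar; unfold s; lra).
          assert (Hd1 : / INR t - / s = / INR t * / s) by (unfold s; field; unfold s in *; lra).
          replace (th / INR t ^ 2) with (th * (/ INR t * / INR t)) by (field; lra).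
          replace (l / 2 * (/ INR t - / INR m) - A) with (l / 2 * (/ INR t * / s))
            by (rewrite <- Hd1; unfold A; ring).
          replace (2 * A / (INR N - INR t)) with (2 * A * / (INR N - INR t)) by reflexivity.
          (* This product supplies the [l ^ 2 / 2] of [th], and the increment [f t - f (S t)]
             supplies the [l / 2]. *)
          assert (P1 : 2 * A * (A + / (INR N - INR t)) <= 2 * (l / 2 * / s) * (l / 2 * / s)).
          { apply Rmult_le_compat; lra. }
          assert (P2 : / s * / s <= / INR t * / INR t) by (apply Rmult_le_compat; lra).
          assert (P3 : / INR t * / s <= / INR t * / INR t) by (apply Rmult_le_compat; lra).
          unfold th. nra.
      + assert (0 <= th / INR t ^ 2).
        { apply Rdiv_le_0_compat; [unfold th; nra|]. now apply pow_lt. }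
        assert (E : forall k : R, 2 * 0 / k = 0) by (intros; unfold Rdiv; ring).
        rewrite E.
        destruct (Nat.leb_spec t m) as [Hs'|Hs']; [|repeat split; lra].
        replace m with t by lia.
        replace ((INR t - INR t) / INR t) with 0 by (field; lra).
        repeat split; lra.
    - unfold g. destruct (Nat.leb_spec N m) as [Hs|Hs]; [|lra].
      assert (m <= N)%nat by (unfold m; apply Nat.Div0.div_le_upper_bound; nia).
      replace N with m by lia.
      replace ((INR m - INR m) / INR m) with 0 by (field; lra). lra. }
  destruct (Zsum_0 n) as [HZ _]; [lia|].
  rewrite (Zsum_factor n th), HZ by lia. rewrite Rmult_assoc.
  apply Rmult_le_compat_l; [apply bridges_nonneg|].
  eapply Rle_trans; [exact Hmain|].
  apply Rmult_le_compat_l; [apply bridges_nonneg|]. apply exp_monotone.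
  unfold g. replace (a <=? m)%nat with true by (symmetry; apply Nat.leb_le; lia).
  assert (Hf : (INR m - INR a) / INR m <= 1).
  { apply Rmult_le_reg_r with (INR m); [lra|].
    replace ((INR m - INR a) / INR m * INR m) with (INR m - INR a) by (field; lra). lra. }
  assert (Hde : d * l <= 2 * e).
  { replace (2 * e) with (2 * e / l * l) by (field; lra).
    apply Rmult_le_compat_r; [lra|]. apply Rmin_r. }
  assert (H1 : T - d * T <= ln (INR m + 1) - ln (INR a + 1) - (INR m - INR a) / INR m) by lra.
  apply Rmult_le_compat_l with (r := l / 2) in H1; [|lra].
  nra.
Qed.

(** The subsolution has leading coefficient [k / t] with [k] slightly above [l / 2]. The drift being
    dropped in [wbridges_ge], no cutoff before the final time occurs. *)
Lemma Zsum_lower l e :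
  0 < l -> 0 < e ->
  eventually (fun n => Zsum n 0 * exp (- (l / 2 + e) * ln (INR n)) <=
    Zsum n ((l ^ 2 + l) / 2)).
Proof.
  intros Hl He. set (th := (l ^ 2 + l) / 2).
  (* Here [k + 2 * k ^ 2 - th >= q] while [6 * p = q / 2], which leaves slack [q / 2]. For [t >= K]
     this slack beats the lower-order terms, and [p] dominates the quartic error. Since
     [k + p <= l / 2 + 2 * e / 3], a share [e / 3] remains for the factor 2 in [N <= 2n]. *)
  set (q := e / 3). set (k := l / 2 + q). set (p := q / 12).
  set (K := k ^ 4 / p + 6 * th / q + 2).
  assert (Hq : 0 < q) by (unfold q; lra).
  assert (Hp : 0 < p) by (unfold p; lra).
  assert (Hk : 0 < k) by (unfold k; lra).
  assert (Hth : 0 < th) by (unfold th; nra).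
  assert (HkK : 0 < k ^ 4 / p) by (apply Rdiv_lt_0_compat; [now apply pow_lt|lra]).
  assert (HtK : 0 < 6 * th / q) by (apply Rdiv_lt_0_compat; lra).
  apply filter_imp with (2 := filter_and _ _
    (eventually_ln_ge (3 * (k + p) * ln 2 / e))
    (filter_and _ _ eventually_Apar_range (eventually_Apar_ge K))).
  intros n ([Hn HT] & HA & HAK).
  set (T := ln (INR n)) in *.
  set (a := (2 * Apar n - 2)%nat). set (N := (2 * n - 2)%nat).
  assert (Ha : K <= INR a).
  { unfold a. rewrite minus_INR, mult_INR by lia. simpl. unfold K in *. lra. }
  assert (HNa : INR a <= INR N) by (apply le_INR; unfold a, N; lia).
  assert (HN : INR N <= 2 * INR n).
  { unfold N. rewrite minus_INR, mult_INR by lia. simpl. lra. }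
  set (al := fun t => p / INR t ^ 2).
  set (be := fun t => k / INR t).
  set (ga := fun t => (k + p) * (ln (INR N) - ln (INR t))).
  assert (Hmain : bridges (2 * n - 2 * Apar n) 0 * exp (- ga a) <=
    wbridges (fun i => th / INR i ^ 2) a (2 * n - 2 * Apar n) 0).
  { pose proof (wbridges_ge (fun i => th / INR i ^ 2) al be ga a N) as HU.
    assert (HU' := fun h1 h2 => HU h1 h2 (2 * n - 2 * Apar n)%nat a 0%Z
      ltac:(unfold a, N; lia) (Nat.le_refl a)). clear HU. cbv beta in HU'.
    replace (- (th / INR a ^ 2) * IZR 0 ^ 2) with 0 in HU' by ring.
    replace (al a * IZR 0 ^ 4 + be a * IZR 0 ^ 2 + ga a) with (ga a) in HU' by ring.
    rewrite exp_0, Rmult_1_l in HU'. apply HU'.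
    - intros t Ht.
      assert (Ht0 : K <= INR t).
      { eapply Rle_trans; [exact Ha|]. apply le_INR. lia. }
      unfold al, be, ga. rewrite S_INR. set (t' := INR t) in *. clearbody t'.
      assert (Ht2 : 2 <= t') by (unfold K in *; lra).
      assert (Hk4 : k ^ 4 <= p * t').
      { replace (k ^ 4) with (p * (k ^ 4 / p)) by (field; lra).
        apply Rmult_le_compat_l; [lra|]. unfold K in *; lra. }
      assert (Hth6 : 6 * th <= q * t').
      { replace (6 * th) with (q * (6 * th / q)) by (field; lra).
        apply Rmult_le_compat_l; [lra|]. unfold K in *; lra. }
      destruct (ln_succ_bounds t') as [Hln _]; [lra|].
      repeat split.
      + apply Rdiv_le_0_compat; [lra|]. apply pow_lt. lra.
      + apply Rdiv_le_0_compat; lra.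
      + apply Rminus_le_0.
        replace (p / t' ^ 2 - (p / (t' + 1) ^ 2 + 4 / 3 * (k / (t' + 1)) ^ 4)) with
          ((p * (2 * t' + 1) * (t' + 1) ^ 2 - 4 / 3 * k ^ 4 * t' ^ 2) / (t' ^ 2 * (t' + 1) ^ 4))
          by (field; lra).
        apply Rdiv_le_0_compat.
        * assert (k ^ 4 * t' ^ 2 <= p * t' * t' ^ 2)
            by (apply Rmult_le_compat_r; [apply pow2_ge_0|lra]).
          assert (p * (t' * t' ^ 2) * (4 / 3) <= p * ((2 * t' + 1) * (t' + 1) ^ 2)).
          { rewrite Rmult_assoc. apply Rmult_le_compat_l; [lra|].
            assert (0 <= t' ^ 3) by (apply pow_le; lra). nra. }
          lra.
        * apply Rmult_lt_0_compat; apply pow_lt; lra.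
      + apply Rminus_le_0.
        replace (k / t' - (th / t' ^ 2 + k / (t' + 1) - 2 * (k / (t' + 1)) ^ 2
          + 6 * (p / (t' + 1) ^ 2))) with
          ((k * t' * (t' + 1) - th * (t' + 1) ^ 2 + 2 * k ^ 2 * t' ^ 2 - 6 * p * t' ^ 2)
           / (t' ^ 2 * (t' + 1) ^ 2)) by (field; lra).
        apply Rdiv_le_0_compat.
        * assert (Hs : q / 2 <= k + 2 * k ^ 2 - th - 6 * p).
          { unfold k, th, p. nra. }
          assert (q / 2 * t' ^ 2 <= (k + 2 * k ^ 2 - th - 6 * p) * t' ^ 2)
            by (apply Rmult_le_compat_r; [apply pow2_ge_0|lra]).
          assert (6 * th * t' <= q * t' * t') by (apply Rmult_le_compat_r; lra).
          assert (0 < th * t') by nra. assert (0 < k * t') by nra. nra.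
        * apply Rmult_lt_0_compat; apply pow_lt; lra.
      + assert (p / (t' + 1) ^ 2 <= p * / (t' + 1)).
        { unfold Rdiv. apply Rmult_le_compat_l; [lra|].
          apply Rinv_le_contravar; nra. }
        unfold Rdiv at 1. nra.
    - unfold ga. lra. }
  destruct (Zsum_0 n) as [HZ _]; [lia|].
  rewrite (Zsum_factor n th), HZ by lia. rewrite Rmult_assoc.
  apply Rmult_le_compat_l; [apply bridges_nonneg|].
  eapply Rle_trans; [|exact Hmain].
  apply Rmult_le_compat_l; [apply bridges_nonneg|]. apply exp_monotone.
  unfold ga.
  assert (Hla : 0 <= ln (INR a)).
  { rewrite <- ln_1. apply ln_le; unfold K in *; lra. }
  assert (HlN : ln (INR N) <= ln 2 + T).
  { unfold T. rewrite <- ln_mult by lra. apply ln_le; unfold K in *; lra. }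
  assert (Hc : (k + p) * ln 2 <= e / 3 * T).
  { replace ((k + p) * ln 2) with (e / 3 * (3 * (k + p) * ln 2 / e)) by (field; lra).
    apply Rmult_le_compat_l; lra. }
  assert (HT0 : 0 < T) by (unfold T; rewrite <- ln_1; apply ln_increasing; lra).
  assert (Hkp : k + p <= l / 2 + 2 * e / 3) by (unfold k, p, q; lra).
  assert ((k + p) * (ln (INR N) - ln (INR a)) <= (k + p) * (ln 2 + T))
    by (apply Rmult_le_compat_l; lra).
  assert ((k + p) * T <= (l / 2 + 2 * e / 3) * T) by (apply Rmult_le_compat_r; lra).
  lra.
Qed.

(** * Upper and lower large-deviation bounds *)

Lemma cond_prob_upper c e :
  0 < c < 1 -> 0 < e ->
  eventually (fun n => cond_prob n c <= exp (- (Kfun c - e) * ln (INR n))).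
Proof.
  (* This [l] minimises [c * (l ^ 2 + l) / 2 - l / 2], and the minimum is [- Kfun c]. *)
  intros Hc He. set (l := (1 - c) / (2 * c)).
  assert (Hl : 0 < l) by (apply Rdiv_lt_0_compat; lra).
  apply filter_imp with (2 := filter_and _ _ eventually_Apar_range (Zsum_upper l e Hl He)).
  intros n [HA HZ]. destruct (Zsum_0 n) as [_ HZ0]; [lia|].
  rewrite cond_prob_eq. set (T := ln (INR n)) in *. set (th := (l ^ 2 + l) / 2) in *.
  assert (Hth : 0 <= th) by (unfold th; nra).
  pose proof (count_le_markov n th (c * T) Hth) as Hm.
  apply Rmult_le_reg_r with (Zsum n 0); [lra|].
  replace (count_le n (c * T) / Zsum n 0 * Zsum n 0) with (count_le n (c * T)) by (field; lra).
  eapply Rle_trans; [exact Hm|].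
  eapply Rle_trans; [apply Rmult_le_compat_l; [left; apply exp_pos|exact HZ]|].
  replace (exp (th * (c * T)) * (Zsum n 0 * exp (- (l / 2 - e) * T))) with
    (exp (th * (c * T)) * exp (- (l / 2 - e) * T) * Zsum n 0) by ring.
  rewrite <- exp_plus. right. f_equal. f_equal.
  unfold th, Kfun, l. field. lra.
Qed.

Lemma cond_prob_lower c e :
  0 < c < 1 -> 0 < e ->
  eventually (fun n => exp (- (Kfun c + e) * ln (INR n)) <= cond_prob n c).
Proof.
  intros Hc He. set (l0 := (1 - c) / (2 * c)).
  assert (Hl0 : 0 < l0) by (apply Rdiv_lt_0_compat; lra).
  assert (Hcl : c * l0 = (1 - c) / 2) by (unfold l0; field; lra).
  (* The tilt is at [l0 + s]. Lowering the level from [c] to [d] costs [th (l0 + s) * 4 * c ^ 2 * s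
     <= 4 * s <= e / 2], where [s <= 1] gives [c ^ 2 * th (l0 + s) <= 1]. *)
  set (s := Rmin 1 (e / 8)).
  assert (Hs1 : s <= 1) by apply Rmin_l.
  assert (Hs2 : s <= e / 8) by apply Rmin_r.
  assert (Hs : 0 < s) by (apply Rmin_glb_lt; lra).
  set (th := fun l : R => (l ^ 2 + l) / 2).
  (* [4 * u = c * s ^ 2 / 2] is the second-order term of [c * th l - l / 2] at its minimiser
     [l0]. *)
  set (u := c * s ^ 2 / 8).
  assert (Hs3 : 0 < s ^ 2) by now apply pow_lt.
  assert (Hu : 0 < u) by (unfold u; nra).
  (* Under the tilt at [l], [L / ln n] is typically near [1 / (2 * l + 1)]: this is [c] at [l0] and
     about [c - 2 * c ^ 2 * s] at [l0 + s], midway between [d] and [c]. *)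
  set (d := c - 4 * c ^ 2 * s).
  assert (Hl1 : 0 < l0 + s) by lra.
  assert (Hl2 : 0 < l0 + 2 * s) by lra.
  apply filter_imp with (2 := filter_and _ _ eventually_Apar_range
    (filter_and _ _ (eventually_ln_ge (Rmax (ln 4 / (2 * u)) (2 * ln 2 / e)))
    (filter_and _ _ (Zsum_lower (l0 + s) u Hl1 Hu)
    (filter_and _ _ (Zsum_upper l0 u Hl0 Hu)
      (Zsum_upper (l0 + 2 * s) u Hl2 Hu))))).
  intros n (HA & [Hn HT] & Z1 & Z0 & Z2). destruct (Zsum_0 n) as [_ HZ0]; [lia|].
  change ((l0 ^ 2 + l0) / 2) with (th l0) in Z0.
  change (((l0 + s) ^ 2 + (l0 + s)) / 2) with (th (l0 + s)) in Z1.
  change (((l0 + 2 * s) ^ 2 + (l0 + 2 * s)) / 2) with (th (l0 + 2 * s)) in Z2.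
  rewrite cond_prob_eq. set (T := ln (INR n)) in *.
  pose proof (Rmax_l (ln 4 / (2 * u)) (2 * ln 2 / e)).
  pose proof (Rmax_r (ln 4 / (2 * u)) (2 * ln 2 / e)).
  assert (HT0 : 0 < T) by (unfold T; rewrite <- ln_1; apply ln_increasing; lra).
  assert (HTu : ln 4 <= 2 * u * T).
  { replace (ln 4) with (2 * u * (ln 4 / (2 * u))) by (field; lra).
    apply Rmult_le_compat_l; lra. }
  assert (HTe : ln 2 <= e / 2 * T).
  { replace (ln 2) with (e / 2 * (2 * ln 2 / e)) by (field; lra).
    apply Rmult_le_compat_l; lra. }
  set (e1 := th (l0 + s) - th l0). set (e2 := th (l0 + 2 * s) - th (l0 + s)).
  assert (Hl0s : 0 < l0 * s) by nra.
  assert (Hth : 0 <= th (l0 + s)) by (unfold th; nra).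
  assert (He1 : 0 <= e1) by (unfold e1, th; nra).
  assert (He2 : 0 <= e2) by (unfold e2, th; nra).
  pose proof (Zsum_tilt n (th (l0 + s)) e1 e2 (c * T) (d * T) Hth He1 He2) as Ht.
  replace (th (l0 + s) - e1) with (th l0) in Ht by (unfold e1; ring).
  replace (th (l0 + s) + e2) with (th (l0 + 2 * s)) in Ht by (unfold e2; ring).
  set (W := exp (- ((l0 + s) / 2 + u) * T)) in *.
  assert (H4 : exp (- ln 4) = / 4) by (rewrite exp_Ropp, exp_ln; lra).
  (* By the choice of [d] and [u], either tail loses at least [2 * u] in the exponent. *)
  assert (T1 : exp (- e1 * (c * T)) * Zsum n (th l0) <= / 4 * (Zsum n 0 * W)).
  { eapply Rle_trans; [apply Rmult_le_compat_l; [left; apply exp_pos|exact Z0]|].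
    replace (exp (- e1 * (c * T)) * (Zsum n 0 * exp (- (l0 / 2 - u) * T))) with
      (Zsum n 0 * (exp (- e1 * (c * T)) * exp (- (l0 / 2 - u) * T))) by ring.
    replace (/ 4 * (Zsum n 0 * W)) with (Zsum n 0 * (/ 4 * W)) by ring.
    apply Rmult_le_compat_l; [lra|]. rewrite <- H4. unfold W. rewrite <- !exp_plus.
    apply exp_monotone.
    assert (E : e1 * c = s / 2 + 4 * u).
    { unfold e1, th, u.
      replace ((((l0 + s) ^ 2 + (l0 + s)) / 2 - (l0 ^ 2 + l0) / 2) * c) with
        (s * (2 * (c * l0) + c * s + c) / 2) by field. rewrite Hcl. field. }
    replace (- e1 * (c * T)) with (- (e1 * c) * T) by ring. rewrite E. lra. }
  assert (T2 : exp (e2 * (d * T)) * Zsum n (th (l0 + 2 * s)) <= / 4 * (Zsum n 0 * W)).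
  { eapply Rle_trans; [apply Rmult_le_compat_l; [left; apply exp_pos|exact Z2]|].
    replace (exp (e2 * (d * T)) * (Zsum n 0 * exp (- ((l0 + 2 * s) / 2 - u) * T))) with
      (Zsum n 0 * (exp (e2 * (d * T)) * exp (- ((l0 + 2 * s) / 2 - u) * T))) by ring.
    replace (/ 4 * (Zsum n 0 * W)) with (Zsum n 0 * (/ 4 * W)) by ring.
    apply Rmult_le_compat_l; [lra|]. rewrite <- H4. unfold W. rewrite <- !exp_plus.
    apply exp_monotone.
    assert (E : e2 * d = s / 2 - 4 * u - 6 * c ^ 2 * s ^ 3).
    { unfold e2, th, u, d.
      replace ((((l0 + 2 * s) ^ 2 + (l0 + 2 * s)) / 2 - ((l0 + s) ^ 2 + (l0 + s)) / 2)
        * (c - 4 * c ^ 2 * s)) with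
        (s * (2 * (c * l0) + 3 * (c * s) + c) / 2 * (1 - 4 * c * s)) by field.
      rewrite Hcl. field. }
    replace (e2 * (d * T)) with (e2 * d * T) by ring. rewrite E.
    assert (0 <= c ^ 2 * s ^ 3) by (apply Rmult_le_pos; apply pow_le; lra).
    nra. }
  (* Each tail takes at most a quarter of the lower bound for the tilted mass, so at least half of
     it comes from [L] between [d * T] and [c * T]. *)
  assert (HC : / 2 * (Zsum n 0 * W) <= exp (- th (l0 + s) * (d * T)) * count_le n (c * T)) by lra.
  apply Rmult_le_reg_r with (Zsum n 0); [lra|].
  replace (count_le n (c * T) / Zsum n 0 * Zsum n 0) with (count_le n (c * T)) by (field; lra).
  apply Rmult_le_reg_l with (exp (- th (l0 + s) * (d * T))); [apply exp_pos|].
  eapply Rle_trans; [|exact HC].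
  replace (/ 2 * (Zsum n 0 * W)) with (/ 2 * W * Zsum n 0) by ring.
  rewrite <- Rmult_assoc. apply Rmult_le_compat_r; [lra|].
  replace (/ 2) with (exp (- ln 2)) by (rewrite exp_Ropp, exp_ln; lra).
  unfold W. rewrite <- !exp_plus. apply exp_monotone.
  assert (E : th (l0 + s) * c - (l0 + s) / 2 = - Kfun c + 4 * u).
  { unfold th, u, Kfun, l0. field. lra. }
  assert (F : th (l0 + s) * (4 * c ^ 2 * s) <= e / 2).
  { assert (c ^ 2 * th (l0 + s) <= 1).
    { assert (th (l0 + s) <= (l0 + 1) ^ 2) by (unfold th; nra).
      apply Rle_trans with (c ^ 2 * (l0 + 1) ^ 2).
      - apply Rmult_le_compat_l; [apply pow2_ge_0|assumption].
      - replace (c ^ 2 * (l0 + 1) ^ 2) with ((c * l0 + c) ^ 2) by ring. rewrite Hcl. nra. }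
    nra. }
  replace (- th (l0 + s) * (d * T)) with
    (- (th (l0 + s) * c) * T + th (l0 + s) * (4 * c ^ 2 * s) * T) by (unfold d; ring).
  replace (th (l0 + s) * c) with (- Kfun c + 4 * u + (l0 + s) / 2) by lra.
  apply Rmult_le_compat_r with (r := T) in F; [|lra].
  assert (0 < u * T) by nra. lra.
Qed.

(** * Passage to the [o(1)] form *)

Theorem theoremt4 :
  forall c : R, 0 < c < 1 ->
  exists f : nat -> R, Un_cv f 0 /\
    exists N : nat, forall n : nat, (N <= n)%nat ->
      cond_prob n c = exp (- (Kfun c + f n) * ln (INR n)).
Proof.
  intros c Hc.
  (* The error term is obtained by solving the claimed equation, so the equation is exact as soon as
     the probability is positive and [ln n > 0]. *)
  exists (fun n => - ln (cond_prob n c) / ln (INR n) - Kfun c). split.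
  - intros e He. assert (He2 : 0 < e / 2) by lra.
    destruct (filter_and _ _ (eventually_ln_ge 1)
      (filter_and _ _ (cond_prob_upper c (e / 2) Hc He2)
        (cond_prob_lower c (e / 2) Hc He2))) as [N HN].
    exists N. intros n Hn. destruct (HN n Hn) as ([_ HT] & Hu & Hl).
    set (T := ln (INR n)) in *. set (P := cond_prob n c) in *.
    assert (HP : 0 < P) by (eapply Rlt_le_trans; [apply exp_pos|exact Hl]).
    apply ln_le in Hu; [|exact HP]. apply ln_le in Hl; [|apply exp_pos].
    rewrite ln_exp in Hu, Hl. unfold Rdist.
    set (y := - ln P / T - Kfun c - 0).
    assert (HyT : y * T = - ln P - Kfun c * T) by (unfold y; field; lra).
    apply Rabs_def1; nra.
  (* The lower bound, with the arbitrary value [e = 1], serves here only for eventual positivity. *)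
  - destruct (filter_and _ _ (eventually_ln_ge 1) (cond_prob_lower c 1 Hc Rlt_0_1))
      as [N HN].
    exists N. intros n Hn. destruct (HN n Hn) as ([_ HT] & Hl).
    assert (HP : 0 < cond_prob n c) by (eapply Rlt_le_trans; [apply exp_pos|exact Hl]).
    rewrite <- (exp_ln (cond_prob n c)) at 1 by exact HP. f_equal. field. lra.
Qed.
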